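(* Let $T=\begin{pmatrix}1&1\\0&1\end{pmatrix}$, $S=\begin{pmatrix}0&1\\-1&0\end{pmatrix}$, $M=\begin{pmatrix}4&2\\-2&1\end{pmatrix}$, and let $\Gamma$ be the subgroup of $\mathrm{Sp}_4(\mathbb Z)$ generated by the block matrices $$\gamma_0=\begin{pmatrix}-STS&M\\0&T\end{pmatrix}=\begin{pmatrix}1&0&4&2\\-1&1&-2&1\\0&0&1&1\\0&0&0&1\end{pmatrix}\quad\text{and}\quad\gamma_1=\begin{pmatrix}0&S\\-S&0\end{pmatrix}=\begin{pmatrix}0&0&0&1\\0&0&-1&0\\0&-1&0&0\\1&0&0&0\end{pmatrix}.$$ Then $\Gamma$ has infinite index in $\mathrm{Sp}_4(\mathbb Z)$. *)

(* Defs.v *)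
From HB Require Import structures.
From mathcomp Require Import all_boot all_order all_algebra.
From mathcomp Require Import mathcomp_extra boolp classical_sets functions.
From mathcomp Require Import cardinality.

Set Implicit Arguments.
Unset Strict Implicit.
Unset Printing Implicit Defensive.

Import GRing.Theory.
Local Open Scope ring_scope.
Local Open Scope classical_set_scope.

Section GroupIndex.
Variable G : groupType.
Implicit Types (H X : set G) (g : G).
Local Open Scope group_scope.

Definition is_subgroup H : Prop :=
  [/\ H 1, forall x y, H x -> H y -> H (x * y) & forall x, H x -> H x^-1].

Definition generated X : set G := smallest is_subgroup X.

Definition left_coset H g : set G := [set g * h | h in H].

Definition left_cosets H : set (set G) := range (left_coset H).

Definition infinite_index H : Prop := infinite_set (left_cosets H).

Lemma generated_subgroup X : is_subgroup (generated X).
Proof.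
split=> [|x y hx hy|x hx].
- by move=> H [[]].
- by move=> H HX; have [[_ HM _] _] := HX; apply: HM; [apply: hx|apply: hy].
- by move=> H HX; have [[_ _ HV] _] := HX; apply: HV; apply: hx.
Qed.

End GroupIndex.

Definition sympl_form : 'M[int]_(2 + 2) := block_mx 0 1%:M (- 1%:M) 0.

Definition symplectic (A : 'M[int]_(2 + 2)) : bool :=
  A^T *m sympl_form *m A == sympl_form.

Record Sp4Z := SpMx { spmx : 'M[int]_(2 + 2); _ : symplectic spmx }.

HB.instance Definition _ := [isSub for spmx].
HB.instance Definition _ := [Choice of Sp4Z by <:].

Lemma spmxP (A : Sp4Z) : symplectic (spmx A).
Proof. exact: valP A. Qed.

Lemma sympl_form_sq : sympl_form *m sympl_form = - 1%:M.
Proof.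
rewrite /sympl_form mulmx_block !mul0mx !mulmx0 !mul1mx !mulmx1 !add0r !addr0.
by rewrite (scalar_mx_block 2 2 1) opp_block_mx !oppr0.
Qed.

Lemma symplectic_unit A : symplectic A -> A \in unitmx.
Proof.
move/eqP=> hA; have: (- sympl_form *m A^T *m sympl_form) *m A = 1%:M.
  by rewrite -!mulmxA (mulmxA A^T) hA mulNmx sympl_form_sq opprK.
by case/mulmx1_unit.
Qed.

Lemma symplectic1 : symplectic 1%:M.
Proof. by rewrite /symplectic trmx1 mul1mx mulmx1. Qed.

Lemma symplecticM A B : symplectic A -> symplectic B -> symplectic (A *m B).
Proof.
move=> /eqP hA /eqP hB; rewrite /symplectic trmx_mul.
by rewrite -!mulmxA (mulmxA A^T) (mulmxA (A^T *m _)) hA mulmxA hB.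
Qed.

Lemma symplecticV A : symplectic A -> symplectic (invmx A).
Proof.
move=> hA; have uA := symplectic_unit hA; move/eqP: hA => hA.
rewrite /symplectic -{1}hA !mulmxA -trmx_mul mulmxV // trmx1 mul1mx.
by rewrite -mulmxA mulmxV // mulmx1.
Qed.

Definition sp_one : Sp4Z := SpMx symplectic1.
Definition sp_mul (A B : Sp4Z) : Sp4Z := SpMx (symplecticM (spmxP A) (spmxP B)).
Definition sp_inv (A : Sp4Z) : Sp4Z := SpMx (symplecticV (spmxP A)).

Lemma sp_mulA : associative sp_mul.
Proof. by move=> A B C; apply: val_inj; rewrite /= mulmxA. Qed.

Lemma sp_mul1 : left_id sp_one sp_mul.
Proof. by move=> A; apply: val_inj; rewrite /= mul1mx. Qed.

Lemma sp_mulr1 : right_id sp_one sp_mul.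
Proof. by move=> A; apply: val_inj; rewrite /= mulmx1. Qed.

Lemma sp_mulV : left_inverse sp_one sp_inv sp_mul.
Proof.
by move=> A; apply: val_inj; rewrite /= mulVmx // symplectic_unit ?spmxP.
Qed.

Lemma sp_mulrV : right_inverse sp_one sp_inv sp_mul.
Proof.
by move=> A; apply: val_inj; rewrite /= mulmxV // symplectic_unit ?spmxP.
Qed.

HB.instance Definition _ :=
  isGroup.Build Sp4Z sp_mulA sp_mul1 sp_mulr1 sp_mulV sp_mulrV.

Definition mx_of_rows (n : nat) (rows : seq (seq int)) : 'M[int]_n :=
  \matrix_(i, j) nth 0 (nth [::] rows i) j.

Definition matT : 'M[int]_2 := mx_of_rows 2 [:: [:: 1; 1]; [:: 0; 1]].
Definition matS : 'M[int]_2 := mx_of_rows 2 [:: [:: 0; 1]; [:: -1; 0]].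
Definition matM : 'M[int]_2 := mx_of_rows 2 [:: [:: 4; 2]; [:: -2; 1]].

Definition gamma0_mx : 'M[int]_(2 + 2) :=
  block_mx (- (matS *m matT *m matS)) matM 0 matT.
Definition gamma1_mx : 'M[int]_(2 + 2) :=
  block_mx 0 matS (- matS) 0.

Lemma gamma0_mxE : gamma0_mx = mx_of_rows 4 [:: [:: 1; 0; 4; 2];
  [:: -1; 1; -2; 1]; [:: 0; 0; 1; 1]; [:: 0; 0; 0; 1]].
Proof.
apply/matrixP => i j; rewrite [RHS]mxE.
rewrite -(fintype.splitK i) -(fintype.splitK j).
by case: (fintype.split i) => -[[|[|[]]] // hi]; case: (fintype.split j) => -[[|[|[]]] // hj];
   rewrite /= ?(block_mxEul, block_mxEur, block_mxEdl, block_mxEdr);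
   rewrite ?(mxE, big_ord_recr, big_ord0) /= ?(mxE, big_ord_recr, big_ord0).
Qed.

Lemma gamma1_mxE : gamma1_mx = mx_of_rows 4 [:: [:: 0; 0; 0; 1];
  [:: 0; 0; -1; 0]; [:: 0; -1; 0; 0]; [:: 1; 0; 0; 0]].
Proof.
apply/matrixP => i j; rewrite [RHS]mxE.
rewrite -(fintype.splitK i) -(fintype.splitK j).
by case: (fintype.split i) => -[[|[|[]]] // hi]; case: (fintype.split j) => -[[|[|[]]] // hj];
   rewrite /= ?(block_mxEul, block_mxEur, block_mxEdl, block_mxEdr);
   rewrite ?mxE.
Qed.

Lemma gamma0_symplectic : symplectic gamma0_mx.
Proof.
rewrite /symplectic /sympl_form /gamma0_mx tr_block_mx !mulmx_block.
rewrite !(mulmx0, mul0mx, mulmx1, mul1mx, add0r, addr0, trmx0, oppr0).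
rewrite !(mulmxN, mulNmx, mulmx1, trmx0, mul0mx, oppr0, add0r, addr0).
apply/eqP; congr block_mx; apply/matrixP => -[[|[|[]]] // hi] [[|[|[]]] // hj];
  by do 4!rewrite ?(mxE, big_ord_recr, big_ord0) /=.
Qed.

Lemma gamma1_symplectic : symplectic gamma1_mx.
Proof.
rewrite /symplectic /sympl_form /gamma1_mx tr_block_mx !mulmx_block.
rewrite !(mulmx0, mul0mx, mulmx1, mul1mx, add0r, addr0, trmx0, oppr0).
rewrite !(mulmxN, mulNmx, mulmx1, trmx0, mul0mx, oppr0, add0r, addr0).
apply/eqP; congr block_mx; apply/matrixP => -[[|[|[]]] // hi] [[|[|[]]] // hj];
  by do 4!rewrite ?(mxE, big_ord_recr, big_ord0) /=.
Qed.

Definition gamma0 : Sp4Z := SpMx gamma0_symplectic.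
Definition gamma1 : Sp4Z := SpMx gamma1_symplectic.

Definition Gamma : set Sp4Z := generated [set gamma0; gamma1].

(* Main.v *)
Require Import Defs.
From mathcomp Require Import all_boot all_order all_algebra.
From mathcomp Require Import classical_sets cardinality.
From mathcomp Require Import zify ring.

(** Write a vector of [Z^4] as [(x, y)] with [x, y] in [Z^2], and put
    [h = 2 x.y], [g = 4 y1^2 + y2^2], [e = x1^2 + 4 x2^2], so [h^2 <= e g].
    The generator [gamma1] exchanges [g] and [e], while
    [(h - g)(gamma0 v) = (h + g)(v)]. If [g > e] at [v], then
    [h - g < 0 < h + g] at [v]; along the orbit [gamma0^k v] this forces
    [h - g > 0] for [k > 0] and [h + g < 0] for [k < 0], and each of these
    implies [g < e]. Hence [<gamma0>] and [<gamma1>] play ping-pong on the cones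
    [g > e] and [g < e].

    The vector [v0 = (0, 2, 1, 0)] satisfies [g < e] along its whole
    [gamma0]-orbit, so its stabilizer in [Gamma] is trivial. As the infinitely
    many powers of the transvection along [v0] fix [v0], they lie in pairwise
    distinct cosets of [Gamma].

    In terms of Lagrangian planes [x = Z y], [gamma0] acts by
    [Z |-> A Z A^T + B] with [B] positive definite and [gamma1] by
    [Z |-> - Z / det Z]; the cone [g > e] is the union of the planes with
    [- P < Z < P], where [P = diag(2, 1/2)] and [gamma0] maps [- P] to [P]. *)

Set Implicit Arguments.
Unset Strict Implicit.
Unset Printing Implicit Defensive.

Import Order.TTheory GRing.Theory Num.Theory.
Local Open Scope ring_scope.

Implicit Types (v : 'cV[int]_(2 + 2)) (b : Sp4Z) (k : int) (n : nat).

(** * Coordinates and the quadratic forms of the ping-pong *)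

Definition coor v (i : nat) : int := v (inord i) 0.

Definition ping_h v := 2 * (coor v 0 * coor v 2 + coor v 1 * coor v 3).
Definition ping_g v := 4 * coor v 2 ^+ 2 + coor v 3 ^+ 2.
Definition ping_e v := coor v 0 ^+ 2 + 4 * coor v 1 ^+ 2.

Lemma coor_mulmx (rows : seq (seq int)) v i : (i < 4)%N ->
  coor (mx_of_rows 4 rows *m v) i =
  let r := nth [::] rows i in
  nth 0 r 0 * coor v 0 + nth 0 r 1 * coor v 1
  + nth 0 r 2 * coor v 2 + nth 0 r 3 * coor v 3.
Proof.
move=> i4; rewrite /coor mxE !big_ord_recr big_ord0 /= add0r !mxE inordK //.
by do ![congr (_ + _)]; congr (_ * v _ _); apply: val_inj; rewrite /= inordK.
Qed.

Definition act b v : 'cV[int]_(2 + 2) := spmx b *m v.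

Lemma act1 v : act 1%g v = v.
Proof. exact: mul1mx. Qed.

Lemma actM b c v : act (b * c)%g v = act b (act c v).
Proof. by rewrite /act mulmxA. Qed.

Lemma actK b v : act b^-1%g (act b v) = v.
Proof. by rewrite -actM mulVg act1. Qed.

Lemma actVK b v : act b (act b^-1%g v) = v.
Proof. by rewrite -actM mulgV act1. Qed.

Lemma coor_gamma0 v : let w := act gamma0 v in
  [/\ coor w 0 = coor v 0 + 4 * coor v 2 + 2 * coor v 3,
      coor w 1 = - coor v 0 + coor v 1 - 2 * coor v 2 + coor v 3,
      coor w 2 = coor v 2 + coor v 3 & coor w 3 = coor v 3].
Proof. by rewrite /act /= gamma0_mxE; split; rewrite coor_mulmx //=; ring. Qed.

Lemma coor_gamma1 v : let w := act gamma1 v in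
  [/\ coor w 0 = coor v 3, coor w 1 = - coor v 2,
      coor w 2 = - coor v 1 & coor w 3 = coor v 0].
Proof. by rewrite /act /= gamma1_mxE; split; rewrite coor_mulmx //=; ring. Qed.

Lemma ping_gamma0 v :
  ping_h (act gamma0 v) - ping_g (act gamma0 v) = ping_h v + ping_g v.
Proof.
by have [c0 c1 c2 c3] := coor_gamma0 v; rewrite /ping_h /ping_g c0 c1 c2 c3; ring.
Qed.

Lemma ping_g_gamma1 v : ping_g (act gamma1 v) = ping_e v.
Proof.
by have [_ _ c2 c3] := coor_gamma1 v; rewrite /ping_g /ping_e c2 c3; ring.
Qed.

Lemma ping_e_gamma1 v : ping_e (act gamma1 v) = ping_g v.
Proof.
by have [c0 c1 _ _] := coor_gamma1 v; rewrite /ping_g /ping_e c0 c1; ring.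
Qed.

Lemma ping_g_ge0 v : 0 <= ping_g v.
Proof. by rewrite /ping_g !expr2; nia. Qed.

Lemma ping_e_ge0 v : 0 <= ping_e v.
Proof. by rewrite /ping_e !expr2; nia. Qed.

(** Lagrange's identity for the vectors [(x1, 2 x2)] and [(2 y1, y2)], with squared norms [e] and
    [g] and inner product [h]. *)
Lemma ping_CauchySchwarz v : ping_h v ^+ 2 <= ping_e v * ping_g v.
Proof.
rewrite -subr_ge0; suff -> : ping_e v * ping_g v - ping_h v ^+ 2 =
    (coor v 0 * coor v 3 - 4 * (coor v 1 * coor v 2)) ^+ 2 by exact: sqr_ge0.
by rewrite /ping_h /ping_g /ping_e; ring.
Qed.

Lemma ping_lt_norm v : ping_g v < `|ping_h v| -> ping_g v < ping_e v.
Proof.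
have := ping_CauchySchwarz v; have := ping_g_ge0 v; have := ping_e_ge0 v.
by rewrite expr2 => *; nia.
Qed.

Lemma ping_norm_lt v : ping_e v < ping_g v -> `|ping_h v| < ping_g v.
Proof.
have := ping_CauchySchwarz v; have := ping_g_ge0 v; have := ping_e_ge0 v.
by rewrite expr2 => *; nia.
Qed.

(** * Orbits of the powers of [gamma0] *)

Definition gamma0_pow k : Sp4Z :=
  match k with
  | Posz n => (gamma0 ^+ n)%g
  | Negz n => (gamma0 ^- n.+1)%g
  end.

Lemma gamma0_powS k : (gamma0 * gamma0_pow k)%g = gamma0_pow (k + 1).
Proof.
case: k => [n|[|n]]; first by rewrite -PoszD addn1 /= expgS.
  by rewrite /= mulgV.
have -> : Negz n.+1 + 1 = Negz n by lia.
by rewrite /= (expgSr _ n.+1) invgM mulgA mulgV mul1g.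
Qed.

Lemma gamma0_powP k : (gamma0^-1 * gamma0_pow k)%g = gamma0_pow (k - 1).
Proof. by rewrite -{1}(subrK 1 k) -gamma0_powS mulgA mulVg mul1g. Qed.

Lemma gamma0_powN k : gamma0_pow (- k) = (gamma0_pow k)^-1%g.
Proof.
case: k => [[|n]|n]; first by rewrite oppr0 /= invg1.
  by rewrite -NegzE.
by rewrite NegzE opprK /= invgK.
Qed.

Lemma ping_gamma0_pos n v : 0 < ping_h v + ping_g v ->
  let w := act (gamma0_pow n.+1) v in 0 < ping_h w - ping_g w.
Proof.
move=> hv; elim: n => [|n IHn] /=; first by rewrite expg1 ping_gamma0.
rewrite expgS actM ping_gamma0; move: IHn => /=; set w := act _ _ => IHn.
by have := ping_g_ge0 w; lia.
Qed.

Lemma ping_gamma0_neg n v : ping_h v - ping_g v < 0 ->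
  let w := act (gamma0_pow (Negz n)) v in ping_h w + ping_g w < 0.
Proof.
move=> hv; elim: n => [|n IHn] /=; rewrite -ping_gamma0 ?expg1 ?actVK //.
rewrite (expgSr _ n.+1) invgM -actM mulgA mulgV mul1g.
move: IHn => /=; set w := act _ _ => IHn.
by have := ping_g_ge0 w; lia.
Qed.

Lemma ping_gamma0_pow v k : `|ping_h v| < ping_g v -> k != 0 ->
  ping_g (act (gamma0_pow k) v) < `|ping_h (act (gamma0_pow k) v)|.
Proof.
move=> hv; case: k => [[|n]|n] // _; set w := act _ v.
  have /(ping_gamma0_pos n) : 0 < ping_h v + ping_g v by lia.
  by rewrite /= -/w; lia.
have /(ping_gamma0_neg n) : ping_h v - ping_g v < 0 by lia.
by rewrite /= -/w; lia.
Qed.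

(** * Normal forms in [Gamma] *)

(* The elements [gamma1 gamma0^k1 ... gamma1 gamma0^km] with [m >= 1] and only
   the last exponent [km] allowed to vanish. *)
Inductive reduced : Sp4Z -> Prop :=
| reduced1 k : reduced (gamma1 * gamma0_pow k)%g
| reducedM k b : k != 0 -> reduced b -> reduced (gamma1 * (gamma0_pow k * b))%g.

Definition normal_form b :=
  exists k, b = gamma0_pow k \/ exists2 c, reduced c & b = (gamma0_pow k * c)%g.

Lemma normal_form_gamma0 b : normal_form b -> normal_form (gamma0 * b)%g.
Proof.
case=> k [->|[c rc ->]]; exists (k + 1); rewrite -gamma0_powS; first by left.
by right; exists c; rewrite ?mulgA.
Qed.

Lemma normal_form_gamma0V b : normal_form b -> normal_form (gamma0^-1 * b)%g.
Proof.
case=> k [->|[c rc ->]]; exists (k - 1); rewrite -gamma0_powP; first by left.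
by right; exists c; rewrite ?mulgA.
Qed.

Lemma gamma1_sq : (gamma1 * gamma1)%g = 1%g.
Proof.
apply: val_inj; rewrite /= /gamma1_mx mulmx_block.
rewrite !(mulmx0, mul0mx, add0r, addr0) (scalar_mx_block 2 2 1).
congr block_mx; apply/matrixP => -[[|[|[]]] // hi] [[|[|[]]] // hj];
  by do 4!rewrite ?(mxE, big_ord_recr, big_ord0) /=.
Qed.

Lemma gamma1V : gamma1^-1%g = gamma1.
Proof. by rewrite -[LHS]mulg1 -gamma1_sq mulgA mulVg mul1g. Qed.

Lemma normal_form_gamma1 b : normal_form b -> normal_form (gamma1 * b)%g.
Proof.
case=> k [->|[c rc ->]].
  exists 0; right; exists (gamma1 * gamma0_pow k)%g; first exact: reduced1.
  by rewrite /= mul1g.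
have [->|k0] := eqVneq k 0; last first.
  exists 0; right; exists (gamma1 * (gamma0_pow k * c))%g; first exact: reducedM.
  by rewrite /= mul1g.
(* For [k = 0] the new [gamma1] cancels the one that starts [c]. *)
rewrite /= mul1g; case: rc => [j|j d _ rd]; rewrite mulgA gamma1_sq mul1g.
  by exists j; left.
by exists j; right; exists d.
Qed.

Lemma Gamma_normal_form b : Gamma b -> normal_form b.
Proof.
(* Asking for both [c] and [c^-1] makes [H] a subgroup; it contains the generators, hence
   [Gamma]. *)
pose H : set Sp4Z := fun c => forall d,
  normal_form d -> normal_form (c * d)%g /\ normal_form (c^-1 * d)%g.
suff hH : H b -> normal_form b.
  move=> /(_ H) Gb; apply/hH/Gb; split; first split.
  - by move=> d; rewrite invg1 !mul1g.
  - move=> x y Hx Hy d nd; rewrite invgM -!mulgA; split.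
      by have [/Hx[]] := Hy d nd.
    by have [_ /Hy[]] := Hx d nd.
  - by move=> x Hx d /Hx[]; rewrite invgK.
  - move=> _ [->|->] d nd; last by rewrite gamma1V; split; exact: normal_form_gamma1.
    by split; [exact: normal_form_gamma0|exact: normal_form_gamma0V].
have n1 : normal_form 1%g by exists 0; left.
by move=> /(_ _ n1)[]; rewrite mulg1.
Qed.

(** * Ping-pong and trivial stabilizers *)

Section TrivialStabilizer.
Variable v : 'cV[int]_(2 + 2).
Hypotheses (v_h : `|ping_h v| < ping_g v) (v_ge : ping_g v < ping_e v).

Lemma orbit_gamma0_ge k :
  ping_g (act (gamma0_pow k) v) < ping_e (act (gamma0_pow k) v).
Proof.
have [->|k0] := eqVneq k 0; first by rewrite /= act1.
exact/ping_lt_norm/ping_gamma0_pow.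
Qed.

Lemma reduced_eg b : reduced b -> ping_e (act b v) < ping_g (act b v).
Proof.
elim=> [k|k c k0 _ IHc]; rewrite !actM ping_g_gamma1 ping_e_gamma1.
  exact: orbit_gamma0_ge.
exact/ping_lt_norm/ping_gamma0_pow/k0/ping_norm_lt.
Qed.

(** A nonzero power of [gamma0] fixing [v] would contradict [v_h]. If [gamma0^k c] fixes [v] with
    [c] reduced, then [c v = gamma0^(-k) v] lies in both cones. *)
Lemma stabilizer_trivial b : Gamma b -> act b v = v -> b = 1%g.
Proof.
move=> /Gamma_normal_form[k [->|[c rc ->]]] bv.
  have [->//|/(ping_gamma0_pow v_h)/=] := eqVneq k 0.
  by rewrite bv ltNge ltW.
have cv : act c v = act (gamma0_pow (- k)) v.
  by rewrite gamma0_powN -{2}bv actM actK.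
by have := reduced_eg rc; rewrite cv ltNge (ltW (orbit_gamma0_ge _)).
Qed.

End TrivialStabilizer.

(** * Transvections and the index *)

Definition transvection_mx v n : 'M[int]_(2 + 2) :=
  1%:M + n%:Z *: (v *m v^T *m sympl_form).

Lemma sympl_form_tr : sympl_form^T = - sympl_form.
Proof.
by rewrite /sympl_form tr_block_mx opp_block_mx !trmx0 linearN /= !trmx1 opprK oppr0.
Qed.

Lemma sympl_form_self v : v^T *m sympl_form *m v = 0.
Proof.
apply/matrixP => i j; rewrite !ord1 [RHS]mxE.
have : (v^T *m sympl_form *m v)^T = - (v^T *m sympl_form *m v).
  by rewrite !trmx_mul trmxK sympl_form_tr mulNmx mulmxN mulmxA.
by move/matrixP => /(_ 0 0); rewrite !mxE; lia.
Qed.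

Lemma transvection_fixes v n : transvection_mx v n *m v = v.
Proof.
rewrite mulmxDl mul1mx -scalemxAl -!mulmxA (mulmxA v^T) sympl_form_self.
by rewrite mulmx0 scaler0 addr0.
Qed.

(** With [J] the form, [E^T J = - J E] and [E^2 = 0], so [(1 + E)^T J (1 + E) = J (1 - E) (1 + E) =
    J]. *)
Lemma transvection_symplectic v n : symplectic (transvection_mx v n).
Proof.
apply/eqP; set E := n%:Z *: (v *m v^T *m sympl_form).
have ETJ : E^T *m sympl_form = - (sympl_form *m E).
  rewrite linearZ /= !trmx_mul trmxK sympl_form_tr -scalemxAl -scalemxAr.
  by rewrite mulNmx mulNmx scalerN !mulmxA.
have E2 : E *m E = 0.
  rewrite -scalemxAl -scalemxAr -!mulmxA (mulmxA sympl_form) (mulmxA v^T).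
  by rewrite (mulmxA v^T sympl_form) sympl_form_self mul0mx mulmx0 !scaler0.
rewrite /transvection_mx -/E [(_ + E)^T]linearD /= trmx1 mulmxDl mul1mx ETJ.
by rewrite mulmxDr mulmx1 mulmxDl mulNmx -mulmxA E2 mulmx0 oppr0 addr0 subrK.
Qed.

Definition transvection v n : Sp4Z := SpMx (transvection_symplectic v n).

Lemma transvection_inj v : v != 0 -> injective (transvection v).
Proof.
move=> /cV0Pn[i vi0] m n /(congr1 spmx)/= /addrI/(congr1 (mulmxr sympl_form)) /=.
(* As [J^2 = -1], multiplying by [J] on the right leaves [- n v v^T], whose diagonal entry
   [- n v_i^2] determines [n]. *)
rewrite -!scalemxAl -!mulmxA sympl_form_sq !mulmxN mulmx1.
move/matrixP => /(_ i i); rewrite !mxE big_ord1 !mxE !mulrN => /oppr_inj.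
by move/mulIf => /(_ (mulf_neq0 vi0 vi0)) [].
Qed.

Lemma infinite_index_stabilizer (H : set Sp4Z) v :
  is_subgroup H -> v != 0 -> (forall b, H b -> act b v = v -> b = 1%g) ->
  infinite_index H.
Proof.
move=> [H1 _ _] v0 stabH fin; pose u := transvection v.
have uv n : act (u n) v = v by exact: transvection_fixes.
have coset_inj : injective (fun n => left_coset H (u n)).
  move=> m n /= eq_mn; apply: (transvection_inj v0); rewrite -/u.
  (* Equal cosets give [u m = u n * c] with [c] in [H]; both transvections fix [v], so [c] does too
     and is trivial. *)
  have : left_coset H (u m) (u m) by exists 1%g => //; rewrite mulg1.
  rewrite eq_mn => -[c Hc ucm]; rewrite -ucm (stabH c) ?mulg1 //.
  by rewrite -[LHS](actK (u n)) -(actM (u n)) ucm uv -{1}(uv n) actK.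
apply: infinite_nat.
have -> : [set: nat]%classic =
    ((fun n => left_coset H (u n)) @^-1` left_cosets H)%classic.
  by apply/seteqP; split=> // n _; exists (u n).
by apply: finite_preimage => // m n _ _; exact: coset_inj.
Qed.

Theorem theoremA1 : infinite_index Gamma.
Proof.
(* At this vector [h = 0], [g = 4] and [e = 16], so [|h| < g < e]. *)
pose v : 'cV[int]_(2 + 2) := \col_i nth 0 [:: 0; 2; 1; 0] i.
have vE i : (i < 4)%N -> coor v i = nth 0 [:: 0; 2; 1; 0] i.
  by move=> i4; rewrite /coor mxE inordK.
apply: (@infinite_index_stabilizer _ v); first exact: generated_subgroup.
  by apply/cV0Pn; exists (inord 1); rewrite -/(coor v 1) vE.
by apply: stabilizer_trivial; rewrite /ping_h /ping_g /ping_e !vE.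
Qed.
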